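(* Let $\mathbb F_q$ be a finite field with $q$ elements and let $G$ be a finite abelian group with exponent $n$ such that $(q,n)=1$. Equip $\mathbb F_qG$ with the classical involution $*:\sum_{g\in G}a_gg\mapsto\sum_{g\in G}a_gg^{-1}$. Then $\mathbb F_qG$ is $*$-clean if and only if one of the following holds: (1) all abelian group codes in $\mathbb F_qG$ are LCD abelian codes; (2) all abelian group codes in $\mathbb F_qG$ are not self-orthogonal abelian codes; (3) there exists an LCD abelian code $\mathcal C_\psi$ in $\mathbb F_qG$ with $\psi\in\hat G$ and $\mathrm{ord}(\psi)=n$; (4) there exists $\psi\in\hat G$ with $\mathrm{ord}(\psi)=n$ such that $\mathcal C_\psi$ is not a self-orthogonal abelian code in $\mathbb F_qG$.
   Context: A $*$-ring is $*$-clean if each of its elements is the sum of a unit and a projection, a projection being an element $e$ with $e^*=e=e^2$. An abelian (group) code in $\mathbb F_qG$ is an ideal of $\mathbb F_qG$. For $a=\sum_{g\in G} a_gg$ and $b=\sum_{g\in G} b_gg$ in $\mathbb F_qG$ put $\langle a,b\rangle=\sum_{g\in G}a_gb_g$. For a code $\mathcal C$ let $\mathcal C^\bot=\{b\in\mathbb F_qG\mid\langle a,b\rangle=0\text{ for all }a\in\mathcal C\}$. $\mathcal C$ is LCD if $\mathcal C\cap\mathcal C^\bot=\{0\}$, and self-orthogonal if $\mathcal C\subset\mathcal C^\bot$ (non-strict inclusion). $\overline{\mathbb F_q}$ is an algebraic closure of $\mathbb F_q$ and $\hat G$ is the group of homomorphisms $\psi:G\to\overline{\mathbb F_q}^{\times}$.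 For $\psi\in\hat G$ of order $d$, let $\omega_d\in\overline{\mathbb F_q}$ be a primitive $d$-th root of unity and $e_\psi=\frac1{|G|}\sum_{g\in G}\psi(g)g\in\mathbb F_q(\omega_d)G$. Set $\mathrm{Tr}_\psi(e_\psi)=\sum_{\sigma\in Gal(\mathbb F_q(\omega_d)/\mathbb F_q)}\sigma(e_\psi)\in\mathbb F_qG$, where $\sigma$ acts on coefficients. $\mathcal C_\psi$ is the ideal of $\mathbb F_qG$ generated by $\mathrm{Tr}_\psi(e_\psi)$. *)

(* Defs.v *)
From HB Require Import structures.
From mathcomp Require Import all_boot all_order all_algebra all_fingroup.
From mathcomp Require Import all_solvable all_field.

Set Implicit Arguments.
Unset Strict Implicit.
Unset Printing Implicit Defensive.

Import GRing.Theory.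
Local Open Scope ring_scope.

(* An alias of {ffun gT -> R}: the product of mathcomp's ring structure on  *)
(* {ffun gT -> R} is pointwise, while the product here is convolution.      *)

Definition grpalg (R : nzRingType) (gT : finGroupType) : predArgType :=
  {ffun gT -> R}.

Section GroupAlgebra.

Variables (R : nzRingType) (gT : finGroupType).
Local Notation A := (grpalg R gT).

HB.instance Definition _ := GRing.Zmodule.on A.

Definition grpalg_one : A := [ffun g => (g == 1%g)%:R].

Definition grpalg_mul (a b : A) : A :=
  [ffun g => \sum_(h : gT) a h * b (h^-1 * g)%g].

Fact grpalg_mulA : associative grpalg_mul.
Proof.
move=> a b c; apply/ffunP=> g; rewrite !ffunE.
under eq_bigr => h _ do rewrite ffunE big_distrr /=.
under [RHS]eq_bigr => h _ do rewrite ffunE big_distrl /=.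
rewrite exchange_big /= [RHS]exchange_big /= exchange_big /=.
apply: eq_bigr => h _.
rewrite [RHS](reindex_inj (mulgI h)) /=.
apply: eq_bigr => k _.
by rewrite mulrA mulKg invMg mulgA.
Qed.

Fact grpalg_mul1 : left_id grpalg_one grpalg_mul.
Proof.
move=> a; apply/ffunP=> g; rewrite !ffunE (bigD1 1%g) //= big1 => [|h nh].
  by rewrite ffunE eqxx mul1r invg1 mul1g addr0.
by rewrite ffunE (negPf nh) mul0r.
Qed.

Fact grpalg_mulr1 : right_id grpalg_one grpalg_mul.
Proof.
move=> a; apply/ffunP=> g; rewrite !ffunE (bigD1 g) //= big1 => [|h nh].
  by rewrite ffunE mulVg eqxx mulr1 addr0.
rewrite ffunE; case: eqP => [/eqP|_]; last by rewrite mulr0.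
by rewrite -eq_mulVg1 (negPf nh).
Qed.

Fact grpalg_mulDl : left_distributive grpalg_mul +%R.
Proof.
move=> a b c; apply/ffunP=> g; rewrite !ffunE -big_split /=.
by apply: eq_bigr => h _; rewrite ffunE mulrDl.
Qed.

Fact grpalg_mulDr : right_distributive grpalg_mul +%R.
Proof.
move=> a b c; apply/ffunP=> g; rewrite !ffunE -big_split /=.
by apply: eq_bigr => h _; rewrite ffunE mulrDr.
Qed.

Fact grpalg_one_neq0 : grpalg_one != 0.
Proof.
apply/eqP=> /ffunP/(_ 1%g) /eqP.
by rewrite !ffunE eqxx oner_eq0.
Qed.

HB.instance Definition _ := GRing.Zmodule_isNzRing.Build A
  grpalg_mulA grpalg_mul1 grpalg_mulr1 grpalg_mulDl grpalg_mulDr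
  grpalg_one_neq0.

Definition grpalg_star (a : A) : A := [ffun g => a g^-1%g].

Definition grpalg_dot (a b : A) : R := \sum_(g : gT) a g * b g.

End GroupAlgebra.

HB.instance Definition _ (R : finNzRingType) (gT : finGroupType) :=
  Finite.copy (grpalg R gT) {ffun gT -> R}.
HB.instance Definition _ (R : finNzRingType) (gT : finGroupType) :=
  FinRing.isNzRing.Build (grpalg R gT).

Definition star_involution (R : nzRingType) (star : R -> R) : Prop :=
  [/\ forall x y, star (x + y) = star x + star y,
      forall x y, star (x * y) = star y * star x
    & forall x, star (star x) = x].

Definition projection (R : nzRingType) (star : R -> R) (e : R) : Prop :=
  star e = e /\ e * e = e.

Definition star_clean (R : unitRingType) (star : R -> R) : Prop :=
  forall x : R, exists u e : R,
    [/\ u \is a GRing.unit, projection star e & x = u + e].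

Lemma grpalg_star_involution (R : comNzRingType) (gT : finGroupType) :
  star_involution (@grpalg_star R gT).
Proof.
split=> [a b|a b|a]; apply/ffunP=> g; rewrite !ffunE ?invgK //.
rewrite [RHS](reindex_inj (mulgI g)) /=; apply: eq_bigr => h _.
by rewrite !ffunE invMg mulgKV invgK mulrC.
Qed.

Section Codes.

Variables (F : finFieldType) (gT : finGroupType).
Local Notation A := (grpalg F gT).

(* mathcomp's idealr_closed requires 1 to lie outside the ideal, so it does *)
(* not apply: the full group algebra is a code.  The zero ideal is also a   *)
(* code, and it is self-orthogonal.                                         *)
Definition abelian_code (C : {set A}) : bool :=
  [&& 0 \in C,
      [forall x in C, forall y in C, x - y \in C]
    & [forall a, forall x in C, (a * x \in C) && (x * a \in C)]].

Definition generated_code (x : A) : {set A} :=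
  \bigcap_(C : {set A} | abelian_code C && (x \in C)) C.

Definition dual_code (C : {set A}) : {set A} :=
  [set b | [forall a in C, grpalg_dot a b == 0]].

Definition LCD (C : {set A}) : bool := C :&: dual_code C == [set 0].

Definition self_orthogonal (C : {set A}) : bool := C \subset dual_code C.

End Codes.

Record algClosure (F : fieldType) := AlgClosure {
  ac_sort :> closedFieldType;
  ac_in : {rmorphism F -> ac_sort};
  ac_integral : integralRange ac_in
}.

Record character (gT : finGroupType) (L : fieldType) := Character {
  char_fun :> gT -> L;
  char_neq0 : forall g, char_fun g != 0;
  charM : forall g h, char_fun (g * h)%g = char_fun g * char_fun h
}.

Section CharacterOrder.

Variables (gT : finGroupType) (L : fieldType) (psi : character gT L).

Lemma char1 : psi 1%g = 1.
Proof. by apply: (mulfI (char_neq0 psi 1%g)); rewrite -charM mulg1 mulr1. Qed.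

Lemma charX g k : psi (g ^+ k)%g = psi g ^+ k.
Proof.
by elim: k => [|k IHk]; rewrite ?char1 // expgS charM exprS IHk.
Qed.

Fact char_order_subproof :
  exists k, (0 < k)%N && [forall g, psi g ^+ k == 1].
Proof.
exists #|[set: gT]|; rewrite cardG_gt0; apply/forallP=> g.
by rewrite -charX expg_cardG ?inE // char1.
Qed.

(* the order of psi in the group of characters under pointwise product *)
Definition char_order : nat := ex_minn char_order_subproof.

Lemma char_order_gt0 : (0 < char_order)%N.
Proof. by rewrite /char_order; case: ex_minnP => k /andP[]. Qed.

Lemma char_orderX g : psi g ^+ char_order = 1.
Proof. by rewrite /char_order; case: ex_minnP => k /andP[_ /forallP/(_ g)/eqP]. Qed.

Lemma char_order_natr_neq0 : char_order%:R != 0 :> L.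
Proof.
apply/negP=> d0.
have [p pcharL] := natf0_pchar char_order_gt0 d0.
have pr_p := pcharf_prime pcharL.
have: (p %| char_order)%N by rewrite (dvdn_pcharf pcharL).
case/dvdnP=> k Dk; have := char_order_gt0; rewrite Dk muln_gt0 => /andP[k0 _].
suff: (char_order <= k)%N.
  by rewrite Dk leqNgt -[X in (X < _)%N]muln1 ltn_pmul2l // prime_gt1.
rewrite /char_order; case: ex_minnP => m _; apply.
rewrite k0; apply/forallP=> g.
have := char_orderX g; rewrite Dk exprM => /eqP; rewrite -subr_eq0.
rewrite -(rmorph1 (pFrobenius_aut pcharL)) -pFrobenius_autE -rmorphB fmorph_eq0.
by rewrite rmorph1 subr_eq0.
Qed.

End CharacterOrder.

Definition omega (L : closedFieldType) (d : nat) : L :=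
  head 0 [seq z <- sval (closed_field_poly_normal ('X^d - 1 : {poly L}))
         | d.-primitive_root z].

Lemma omega_prim (L : closedFieldType) d :
  d%:R != 0 :> L -> d.-primitive_root (omega L d).
Proof.
move=> nz_d; rewrite /omega; case: closed_field_poly_normal => rs /= Drs.
have d_gt0: (0 < d)%N by case: d nz_d {Drs} => //; rewrite eqxx.
rewrite (monicP (monic_Xn_sub_1 _ d_gt0)) scale1r in Drs.
have Urs: uniq rs by rewrite -separable_prod_XsubC -Drs separable_Xn_sub_1.
have sz: size rs = d.
  by apply: succn_inj; rewrite -(size_prod_XsubC _ id) -Drs size_Xn_sub_1.
have: has d.-primitive_root rs.
  apply: (has_prim_root d_gt0 _ Urs); last by rewrite sz.
  apply/allP=> z; rewrite -root_prod_XsubC -Drs.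
  by rewrite unity_rootE rootE !hornerE subr_eq0.
rewrite has_filter; case E: [seq _ <- _ | _] => [|x s] //= _.
have: x \in [seq z <- rs | d.-primitive_root z] by rewrite E mem_head.
by rewrite mem_filter => /andP[].
Qed.


Section Adjunction.

Variables (F : finFieldType) (L : algClosure F) (z : L).

(* A model of the subfield F(z) of L as an abstract extension of F, so that *)
(* the library's Galois groups apply to it.                                 *)
Record simpleExt := SimpleExt {
  se_sort : splittingFieldType F;
  se_in : {rmorphism se_sort -> L};
  se_inA : forall a : F, se_in a%:A = ac_in L a;
  se_gen : exists2 w, se_in w = z & <<1; w>>%VS = fullv
}.

Fact adjoin_minpoly : {p : {poly F} | p != 0 /\ root (map_poly (ac_in L) p) z
  & forall q, root (map_poly (ac_in L) q) z -> q != 0 -> (size p <= size q)%N}.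
Proof.
pose P n (r : 'rV[F]_n) :=
  (rVpoly r != 0) && root (map_poly (ac_in L) (rVpoly r)) z.
have PE q : root (map_poly (ac_in L) q) z -> q != 0 ->
    [exists r : 'rV[F]_(size q), P _ r].
  by move=> qz nzq; apply/existsP; exists (poly_rV q); rewrite /P poly_rV_K ?nzq.
have exP : exists n, [exists r : 'rV[F]_n, P n r].
  have [q mon_q qz] := ac_integral z.
  by exists (size q); apply: PE => //; apply: monic_neq0.
case: (ex_minnP exP) => m /existsP Pm min_m.
have Pr := xchooseP Pm; set r := xchoose Pm in Pr.
exists (rVpoly r); first by apply/andP.
move=> q qz nzq; apply: leq_trans (size_poly _ _) _.
exact: min_m (PE q qz nzq).
Qed.

Fact adjoin : simpleExt.
Proof.
have [p [nz_p pz] min_p] := adjoin_minpoly.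
have irr_p : irreducible_poly p by apply/(subfx_irreducibleP pz nz_p).
pose E := FinSplittingFieldType F (SubFieldExtType pz irr_p).
pose j : {rmorphism E -> L} :=
  (subfx_inj : {rmorphism subFExtend (ac_in L) z p -> L}).
apply: (@SimpleExt E j).
  by move=> a; apply: (subfx_inj_base pz nz_p).
exists (subfx_root (ac_in L) z p).
  exact: (subfx_inj_root pz nz_p).
apply/vspaceP=> x; rewrite memvf.
have [q ->] := subfxEroot pz nz_p x.
apply: rpred_horner; last exact: memv_adjoin.
apply/polyOverP=> i; rewrite coef_map /=.
by apply: (subvP (subv_adjoin _ _)); apply: rpredZ; apply: mem1v.
Qed.

Definition adjoin_preim (K : simpleExt) (y : L) : se_sort K :=
  odflt 0 [pick x : finvect_type (se_sort K) | se_in K x == y].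

End Adjunction.

Section CharacterCode.

Variables (F : finFieldType) (gT : finGroupType) (L : algClosure F).
Variable psi : character gT L.

Definition char_field : simpleExt (omega L (char_order psi)) :=
  adjoin (omega L (char_order psi)).

Local Notation K := (se_sort char_field).

Definition char_idem : grpalg L gT :=
  [ffun g => (#|[set: gT]|%:R)^-1 * psi g].

(* char_idem, seen with coefficients in F(omega) *)
Definition char_idem_ext : grpalg K gT :=
  [ffun g => adjoin_preim char_field (char_idem g)].

Definition char_trace_ext : grpalg K gT :=
  [ffun g => \sum_(s in 'Gal({:K} / 1)%g) s (char_idem_ext g)].

(* char_trace_ext, seen with coefficients in F *)
Definition char_trace : grpalg F gT :=
  [ffun g => odflt 0 [pick a : F | a%:A == char_trace_ext g]].

Definition char_code : {set grpalg F gT} := generated_code char_trace.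

(* char_idem_extE and char_traceE: neither change of coefficients above     *)
(* ever takes its default value.                                            *)
Lemma char_idem_extE g : se_in char_field (char_idem_ext g) = char_idem g.
Proof.
rewrite !ffunE /adjoin_preim; case: pickP => [x /eqP //|no_x].
have [w Dw _] := se_gen char_field.
have prim_w := omega_prim (char_order_natr_neq0 psi).
have [i Di] := prim_rootP prim_w (char_orderX psi g).
pose x : K := (#|[set: gT]|%:R)^-1 * w ^+ i.
have /eqP[] := no_x x.
by rewrite rmorphM fmorphV rmorph_nat rmorphXn /= Dw Di.
Qed.

Lemma char_traceE g : (char_trace g)%:A = char_trace_ext g.
Proof.
rewrite ffunE; case: pickP => [a /eqP //|no_a].
have: char_trace_ext g \in 1%VS.
  rewrite ffunE; apply: (@mem_galTrace _ _ 1%AS {:K}%AS); last exact: memvf.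
  exact: (finField_galois (sub1v _)).
by case/vlineP=> a Da; have /eqP[] := no_a a.
Qed.

End CharacterCode.

(* Main.v *)
Require Import Defs.
From HB Require Import structures.
From mathcomp Require Import all_boot all_order all_algebra all_fingroup.
From mathcomp Require Import all_solvable all_field.

Set Implicit Arguments.
Unset Strict Implicit.
Unset Printing Implicit Defensive.

Import GRing.Theory.
Local Open Scope ring_scope.

(** Write q for the order of F, A for the group algebra F G and a* for the
    image of a under the classical involution.

    Everything rests on one computation in A (grpalg_exprq): since A is
    commutative of characteristic p and c ^ q = c in F, raising an element to
    the power q ^ m fixes its coefficients and replaces each group element g by
    g ^ (q ^ m).  Two choices of m matter.

    If q ^ m = 1 mod n, the map is the identity.  So every x satisfies
    x ^ Q = x with Q > 1, whence x ^ (Q - 1) is an idempotent that generates the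
    same ideal as x, and every x is the sum of a unit and an idempotent.  On the
    other hand, an idempotent f is the sum of a unit and an idempotent e only
    for e = 1 - f.  Hence A is star-clean if and only if every idempotent is
    fixed by the involution (star_cleanP).  As the dual of an ideal C consists
    of the b with a b* = 0 for all a in C (dual_codeP), this is in turn
    equivalent to all codes being LCD (star_clean_LCD), which is condition (1)
    and settles one implication.

    If q ^ m = -1 mod n, the map is the involution itself, and then e* = e ^
    (q ^ m) = e for every idempotent e.  Conditions (3) and (4) provide such an
    m.  Let f be the trace of the idempotent of psi.  It is nonzero, because the
    Galois group acts faithfully on the conjugates of psi (char_trace_neq0), so
    an LCD code generated by f is not self-orthogonal, and (3) reduces to (4).
    If the code is not self-orthogonal then f f* is nonzero.  By orthogonality
    of characters, some Galois conjugate of psi is then the inverse of psi; the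
    Galois group being generated by the Frobenius automorphism, this means
    psi ^ (q ^ t) = psi ^ -1, so that the order n of psi divides q ^ t + 1
    (char_inverse_conjugate).

    Condition (2) never holds, because the zero ideal is self-orthogonal. *)

(** * Periodic elements and idempotents in rings *)

Lemma card_finField_exp_gt0 (F : finFieldType) m : (0 < #|F| ^ m)%N.
Proof. by rewrite expn_gt0 ltnW ?finNzRing_gt1. Qed.

Lemma idem_exprS (R : nzRingType) (e : R) k : e * e = e -> e ^+ k.+1 = e.
Proof. by move=> ee; elim: k => [|k IHk]; rewrite ?expr1 // exprS IHk. Qed.

Lemma idem_of_periodic (R : nzRingType) (x : R) N :
  x ^+ N.+2 = x -> x ^+ N.+1 * x ^+ N.+1 = x ^+ N.+1.
Proof.
by move=> xN; rewrite -exprD addSnnS exprD xN -exprSr.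
Qed.

(** The idempotent f = x ^ N.+1 splits the ring; x is invertible in the corner
    of f, with inverse x ^ N f, and vanishes in the corner of 1 - f, where
    subtracting 1 - f makes it -1. *)
Lemma periodic_unit (R : unitRingType) (x : R) N :
  x ^+ N.+2 = x -> x - (1 - x ^+ N.+1) \is a GRing.unit.
Proof.
move=> xN; have ff := idem_of_periodic xN.
set f := x ^+ N.+1 in ff *.
have xf : x * f = x by rewrite -exprS.
have fx : f * x = x by rewrite -exprSr.
have yf : x ^+ N * f * f = x ^+ N * f by rewrite -mulrA ff.
have fy : f * (x ^+ N * f) = x ^+ N * f.
  by rewrite mulrA -exprD addnC exprD -/f yf.
have yx : x ^+ N * f * x = f by rewrite -mulrA fx -exprSr.
have xy : x * (x ^+ N * f) = f by rewrite mulrA -exprS.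
have [c Dc] : {c | c = 1 - f} by exists (1 - f).
have [xc cx] : x * c = 0 /\ c * x = 0.
  by rewrite Dc mulrBr mulrBl mulr1 mul1r xf fx subrr.
have [yc cy] : x ^+ N * f * c = 0 /\ c * (x ^+ N * f) = 0.
  by rewrite Dc mulrBr mulrBl mulr1 mul1r yf fy subrr.
have cc : c * c = c by rewrite Dc mulrBr mulr1 mulrBl mul1r ff subrr subr0.
have fc : f + c = 1 by rewrite Dc addrC subrK.
rewrite -Dc; apply/unitrP; exists (x ^+ N * f - c).
by rewrite !mulrBl !mulrBr yx xy xc cx yc cy cc subr0 sub0r opprK fc.
Qed.

(** The products e f and (1 - e) (1 - f) are both annihilated by f - e, hence
    vanish when f - e is a unit. *)
Lemma complement_of_idem_unit (R : unitRingType) (e f : R) :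
  e * f = f * e -> e * e = e -> f * f = f -> f - e \is a GRing.unit ->
  e = 1 - f.
Proof.
move=> ef ee ff Uu.
have ef0 : e * f = 0.
  have efe : e * f * e = e * f by rewrite ef -mulrA ee.
  by apply: (mulIr Uu); rewrite mul0r mulrBr efe -mulrA ff subrr.
have : 1 - f - e = 0.
  apply: (mulIr Uu); rewrite mul0r !mulrBl !mul1r !mulrBr ff ee -ef ef0.
  by rewrite subr0 sub0r opprK addrAC subrK subrr.
by move/subr0_eq.
Qed.

(** * The group algebra and its involution *)

Section GroupAlgebra.

Variables (R : comNzRingType) (gT : finGroupType).
Local Notation A := (grpalg R gT).
Implicit Types a b : A.

Lemma grpalg_starM a b : grpalg_star (a * b) = grpalg_star b * grpalg_star a.
Proof. by have [_ ->] := grpalg_star_involution R gT. Qed.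

Lemma grpalg_starK : involutive (@grpalg_star R gT).
Proof. by have [_ _ ?] := grpalg_star_involution R gT. Qed.

Lemma grpalg_starB a b : grpalg_star (a - b) = grpalg_star a - grpalg_star b.
Proof. by apply/ffunP=> g; rewrite !ffunE. Qed.

Lemma grpalg_star1 : grpalg_star 1 = 1 :> A.
Proof. by apply/ffunP=> g; rewrite !ffunE eq_invg1. Qed.

(** The inner product is the coefficient of the neutral element in a b*; this
    is what lets the ideal structure control duality. *)
Lemma grpalg_dotE a b : grpalg_dot a b = (a * grpalg_star b) 1%g.
Proof.
by rewrite ffunE; apply: eq_bigr => g _; rewrite ffunE mulg1 invgK.
Qed.

Lemma grpalg_mulC : abelian [set: gT] -> commutative (@grpalg_mul R gT).
Proof.
move=> abelG a b; apply/ffunP=> g; rewrite !ffunE.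
have mulgC (x y : gT) : (x * y = y * x)%g.
  by apply: (centsP abelG); rewrite inE.
rewrite (reindex_inj (inj_comp (mulIg g) invg_inj)) /=.
by apply: eq_bigr => h _; rewrite invMg invgK -mulgA (mulgC h) mulKg mulrC.
Qed.

Definition monomial (c : R) (g : gT) : A := [ffun h => if h == g then c else 0].

Lemma grpalg_sum_monomial a : a = \sum_g monomial (a g) g.
Proof.
apply/ffunP=> h; rewrite sum_ffunE (bigD1 h) //= big1 => [|g ng].
  by rewrite ffunE eqxx addr0.
by rewrite ffunE eq_sym (negPf ng).
Qed.

Lemma monomialM c d g h :
  monomial c g * monomial d h = monomial (c * d) (g * h).
Proof.
apply/ffunP=> k; rewrite !ffunE (bigD1 g) //= big1 => [|i ni].
  rewrite !ffunE eqxx addr0 -(inj_eq (mulgI g)) mulKVg.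
  by case: eqP; rewrite ?mulr0.
by rewrite ffunE (negPf ni) mul0r.
Qed.

Lemma monomialX c g k : monomial c g ^+ k = monomial (c ^+ k) (g ^+ k)%g.
Proof.
elim: k => [|k IHk]; last by rewrite exprS IHk monomialM exprS expgS.
by apply/ffunP=> h; rewrite !ffunE; case: eqP.
Qed.

(** The trace form on the group algebra is nondegenerate: multiplying by group
    elements moves every coefficient of a to the neutral element. *)
Lemma grpalg_mul_eq0 a : (forall b, (b * a) 1%g = 0) -> a = 0.
Proof.
move=> a0; apply/ffunP=> g; rewrite [RHS]ffunE -(a0 (monomial 1 g^-1%g)) ffunE.
rewrite (bigD1 g^-1%g) //= big1 => [|h nh].
  by rewrite ffunE eqxx mul1r addr0 invgK mulg1.
by rewrite ffunE (negPf nh) mul0r.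
Qed.

End GroupAlgebra.

(** * Powers of the order of the field *)

Section Frobenius.

Variables (F : finFieldType) (gT : finGroupType).
Hypothesis abelG : abelian [set: gT].
Local Notation A := (grpalg F gT).

(** Freshman's dream in the commutative ring A, followed by c ^ q = c for the
    coefficients. *)
Lemma grpalg_exprq (a : A) m :
  a ^+ (#|F| ^ m) = \sum_g monomial (a g) (g ^+ (#|F| ^ m))%g.
Proof.
have [p p_pr pcharF] := finPcharP F.
(* commutativity of A depends on a hypothesis, so the structure is local *)
pose B : comNzRingType := HB.pack A
  (GRing.PzRing_hasCommutativeMul.Build A (@grpalg_mulC F gT abelG)).
have pcharB : p \in [pchar B].
  apply/andP; split=> //; apply/eqP/ffunP=> g.
  by rewrite ffunMnE /= -mulr_natr (pcharf0 pcharF) mulr0 ffunE.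
have pF : [pchar B].-nat (#|F| ^ m)%N.
  rewrite pnatX; apply/orP; left.
  rewrite (eq_pnat _ (pcharf_eq pcharB)).
  have Dq : #|F| = (p ^ logn p #|F|)%N := card_pprimeChar pcharF.
  by rewrite Dq pnatX pnat_id.
have q_gt0 := card_finField_exp_gt0 F m.
rewrite {1}[a]grpalg_sum_monomial.
rewrite (big_morph (fun x : B => x ^+ (#|F| ^ m)) (id1 := 0) (op1 := +%R)).
- apply: eq_bigr => g _; rewrite monomialX; congr (monomial _ _).
  elim: m {pF q_gt0} => [|m IHm]; first by rewrite expr1.
  by rewrite expnSr exprM IHm expf_card.
- by move=> x y; rewrite exprDn_pchar.
by rewrite expr0n gtn_eqF.
Qed.

Lemma grpalg_exprq_id (a : A) m :
  (forall g : gT, g ^+ (#|F| ^ m) = g)%g -> a ^+ (#|F| ^ m) = a.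
Proof.
move=> gq; rewrite grpalg_exprq [RHS]grpalg_sum_monomial.
by apply: eq_bigr => g _; rewrite gq.
Qed.

Lemma grpalg_exprq_star (a : A) m :
  (forall g : gT, g ^+ (#|F| ^ m) = g^-1)%g -> a ^+ (#|F| ^ m) = grpalg_star a.
Proof.
move=> gq; rewrite grpalg_exprq [RHS]grpalg_sum_monomial.
rewrite [RHS](reindex_inj invg_inj) /=.
by apply: eq_bigr => g _; rewrite gq ffunE invgK.
Qed.

(** With m = totient n, raising to the power q ^ m fixes every group element.
    This also shows that A is reduced, and so stands for Maschke's theorem. *)
Lemma grpalg_periodic : coprime #|F| (exponent [set: gT]) ->
  exists N, forall a : A, a ^+ N.+2 = a.
Proof.
set n := exponent _ => coqn.
have n_gt0 : (0 < n)%N by apply: exponent_gt0.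
have m_gt0 : (0 < totient n)%N by rewrite totient_gt0.
have q_gt1 : (1 < #|F| ^ totient n)%N.
  by rewrite -(exp1n (totient n)) ltn_exp2r // finNzRing_gt1.
exists (#|F| ^ totient n).-2 => a.
have -> : (#|F| ^ totient n).-2.+2 = (#|F| ^ totient n)%N.
  by case: (_ ^ _)%N q_gt1 => [|[|]].
apply: grpalg_exprq_id => g; apply/eqP; rewrite -[X in _ == X]expg1.
rewrite eq_expg_mod_order.
have := Euler_exp_totient coqn => /eqP; rewrite !eqn_mod_dvd ?(ltnW q_gt1) //.
by apply: dvdn_trans; apply: dvdn_exponent; rewrite inE.
Qed.

End Frobenius.

(** * Duality of ideals and star-cleanness *)

Section CodeDuality.

Variables (F : finFieldType) (gT : finGroupType).
Local Notation A := (grpalg F gT).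
Implicit Types (a b x : A) (C : {set A}).

Lemma code_mull C a x : abelian_code C -> x \in C -> a * x \in C.
Proof.
by case/and3P=> _ _ /forallP/(_ a)/forall_inP Cax /Cax/andP[].
Qed.

(** Since C is an ideal, orthogonality of b to all multiples of a makes every
    coefficient of a b* vanish, not only that of the neutral element. *)
Lemma dual_codeP C b : abelian_code C ->
  reflect (forall a, a \in C -> a * grpalg_star b = 0) (b \in dual_code C).
Proof.
move=> codeC; rewrite inE; apply: (iffP forall_inP) => Cb a Ca.
  apply: grpalg_mul_eq0 => c.
  by rewrite mulrA -grpalg_dotE; apply/eqP/Cb/code_mull.
by rewrite grpalg_dotE Cb // ffunE.
Qed.

Lemma LCDP C : abelian_code C ->
  reflect (forall x, x \in C -> x \in dual_code C -> x = 0) (LCD C).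
Proof.
move=> codeC; have [C0 _ _] := and3P codeC.
apply: (iffP eqP) => [CC x Cx C'x | CC].
  by apply/set1P; rewrite -CC inE Cx.
apply/setP=> x; rewrite in_setI in_set1.
apply/andP/eqP => [[]|->]; first exact: CC.
split=> //; apply/(dual_codeP _ codeC) => a _.
by apply/ffunP=> g; rewrite !ffunE big1 // => h _; rewrite !ffunE mulr0.
Qed.

Hypothesis abelG : abelian [set: gT].

Lemma mem_generated_code x y :
  reflect (exists a, y = a * x) (y \in generated_code x).
Proof.
apply: (iffP bigcapP) => [yP | [a ->] C /andP[codeC Cx]]; last exact: code_mull.
pose C := [set a * x | a : A].
have /yP/imsetP[a _ ->] : abelian_code C && (x \in C); last by exists a.
apply/andP; split; last by apply/imsetP; exists 1; rewrite ?mul1r.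
apply/and3P; split.
- by apply/imsetP; exists 0; rewrite ?mul0r.
- apply/forall_inP=> _ /imsetP[a _ ->]; apply/forall_inP=> _ /imsetP[b _ ->].
  by apply/imsetP; exists (a - b); rewrite ?mulrBl.
apply/forallP=> c; apply/forall_inP=> _ /imsetP[a _ ->].
rewrite [_ * c](grpalg_mulC abelG) andbb.
by apply/imsetP; exists (c * a); rewrite ?mulrA.
Qed.

Lemma generated_code_code x : abelian_code (generated_code x).
Proof.
apply/and3P; split.
- by apply/mem_generated_code; exists 0; rewrite mul0r.
- apply/forall_inP=> _ /mem_generated_code[a ->].
  apply/forall_inP=> _ /mem_generated_code[b ->].
  by apply/mem_generated_code; exists (a - b); rewrite mulrBl.
apply/forallP=> c; apply/forall_inP=> _ /mem_generated_code[a ->].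
rewrite [_ * c](grpalg_mulC abelG) andbb.
by apply/mem_generated_code; exists (c * a); rewrite mulrA.
Qed.

Lemma generated_code_self_orthogonal x :
  x * grpalg_star x = 0 -> self_orthogonal (generated_code x).
Proof.
move=> xx0; apply/subsetP=> _ /mem_generated_code[a ->].
apply/(dual_codeP _ (generated_code_code x)) => _ /mem_generated_code[b ->].
by rewrite grpalg_starM mulrA -(mulrA b) xx0 mulr0 mul0r.
Qed.

Lemma self_orthogonal_LCD_eq0 x :
  self_orthogonal (generated_code x) -> LCD (generated_code x) -> x = 0.
Proof.
move=> /subsetP so /(LCDP (generated_code_code x)); apply; last apply: so.
  by apply/mem_generated_code; exists 1; rewrite mul1r.
by apply/mem_generated_code; exists 1; rewrite mul1r.
Qed.

Hypothesis coqn : coprime #|F| (exponent [set: gT]).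

(** For commuting idempotents e and f, f - e can only be a unit when e = 1 - f,
    so a star-clean decomposition of f forces 1 - f to be a projection.
    Conversely periodicity splits x by the idempotent x ^ N.+1. *)
Lemma star_cleanP :
  star_clean (@grpalg_star F gT) <->
  (forall e : A, e * e = e -> grpalg_star e = e).
Proof.
split=> [clean f ff | idem_fix x].
  have [u [e [Uu [se ee] Df]]] := clean f.
  have {}Df : e = 1 - f.
    apply: complement_of_idem_unit ee ff _; first exact: grpalg_mulC.
    by rewrite Df addrK.
  have := se; rewrite Df grpalg_starB grpalg_star1.
  by move/addrI/oppr_inj.
have [N perN] := grpalg_periodic abelG coqn.
have ff := idem_of_periodic (perN x); set f := x ^+ N.+1 in ff *.
exists (x - (1 - f)), (1 - f); split; last by rewrite subrK.
  exact: periodic_unit.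
split; first by rewrite grpalg_starB grpalg_star1 idem_fix.
by rewrite mulrBr mulr1 mulrBl mul1r ff subrr subr0.
Qed.

(** A nonzero x in the intersection of C with its dual would give an idempotent
    f in C, a power of x, with x f = x and f x* = 0; if f* = f, applying the
    involution gives x = x f = 0.  For the converse, the product of f and 1 - f*
    lies both in the ideal of f and in its dual, so f = f f*, which is fixed by
    the involution. *)
Lemma star_clean_LCD : star_clean (@grpalg_star F gT) <->
  (forall C, abelian_code C -> LCD C).
Proof.
split=> [/star_cleanP idem_fix C codeC | allLCD].
  apply/(LCDP codeC) => x Cx /(dual_codeP _ codeC) C'x.
  have [N perN] := grpalg_periodic abelG coqn.
  have xs0 : x ^+ N.+1 * grpalg_star x = 0.
    by apply: C'x; rewrite exprSr code_mull.
  rewrite -(perN x) exprS -(idem_fix _ (idem_of_periodic (perN x))).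
  rewrite -[x in LHS]grpalg_starK -grpalg_starM grpalg_starK xs0.
  by apply/ffunP=> g; rewrite !ffunE.
apply/star_cleanP=> f ff.
have ffs : f * (1 - grpalg_star f) = 0.
  apply: (LCDP (generated_code_code f) (allLCD _ (generated_code_code f))).
    apply/mem_generated_code; exists (1 - grpalg_star f).
    exact: grpalg_mulC.
  apply/(dual_codeP _ (generated_code_code f)) => _ /mem_generated_code[a ->].
  rewrite grpalg_starM grpalg_starB grpalg_star1 grpalg_starK mulrA.
  by rewrite -[a * f * _]mulrA mulrBr mulr1 ff subrr mulr0 mul0r.
move/eqP: ffs; rewrite mulrBr mulr1 subr_eq0 => /eqP ffs.
by rewrite {1}ffs grpalg_starM grpalg_starK -ffs.
Qed.

End CodeDuality.

(** * Characters and Galois conjugation *)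

Lemma char_order_dvd (gT : finGroupType) (L : fieldType)
    (psi : character gT L) k :
  (forall g, psi g ^+ k = 1) -> (char_order psi %| k)%N.
Proof.
move=> psik; have psid := char_orderX psi.
case: (posnP (k %% char_order psi)%N) => [/eqP // | r_gt0].
suff: (char_order psi <= k %% char_order psi)%N.
  by rewrite leqNgt ltn_pmod // char_order_gt0.
rewrite {1}/char_order; case: ex_minnP => m _; apply; rewrite r_gt0 /=.
apply/forallP=> g; have := psik g.
rewrite {1}(divn_eq k (char_order psi)) exprD mulnC exprM psid expr1n mul1r.
by move=> ->.
Qed.

Lemma char_sum_eq0 (gT : finGroupType) (R : idomainType) (chi : gT -> R) g :
  (forall h k, chi (h * k)%g = chi h * chi k) -> chi g != 1 ->
  \sum_h chi h = 0.
Proof.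
move=> chiM chig; apply/eqP; have/eqP : (chi g - 1) * \sum_h chi h = 0.
  rewrite mulrBl mul1r mulr_sumr [X in _ - X](reindex_inj (mulgI g)) /=.
  by rewrite -sumrB big1 // => h _; rewrite chiM subrr.
by rewrite mulf_eq0 subr_eq0 (negPf chig).
Qed.

(** The Galois group of a finite field is generated by the Frobenius. *)
Lemma gal_expr (F : finFieldType) (K : splittingFieldType F)
    (s : gal_of {:K}) : s \in 'Gal({:K} / 1)%g ->
  exists i, forall x, s x = x ^+ (#|F| ^ i).
Proof.
have [alpha /eqP-> Dalpha] := finField_galois_generator (sub1v {:K}%AS).
case/cycleP=> i ->; exists i => x.
elim: i => [|i IHi]; first by rewrite expg0 gal_id expr1.
rewrite expgSr galM ?memvf // IHi Dalpha ?memvf //.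
by rewrite dimv1 expn1 -exprM -expnSr.
Qed.

(** A group and its exponent have the same prime divisors. *)
Lemma card_group_neq0 (F : finFieldType) (gT : finGroupType) :
  coprime #|F| (exponent [set: gT]) -> #|[set: gT]|%:R != 0 :> F.
Proof.
move=> coqn; apply/negP=> nG0.
have [p pcharF] := natf0_pchar (cardG_gt0 [set: gT]) nG0.
have p_pr := pcharf_prime pcharF.
have : (p %| 1)%N; last by rewrite dvdn1; case: eqP p_pr => [->|].
rewrite -(eqP coqn) dvdn_gcd; apply/andP; split.
  have Dq : #|F| = (p ^ logn p #|F|)%N := card_pprimeChar pcharF.
  rewrite Dq dvdn_exp // lt0n; apply/eqP=> e0.
  by have := finNzRing_gt1 F; rewrite Dq e0.
have : p \in \pi([set: gT]).
  by rewrite mem_primes p_pr cardG_gt0 (dvdn_pcharf pcharF).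
by rewrite -pi_of_exponent mem_primes => /and3P[].
Qed.

Section CharacterIdempotents.

Variables (F : finFieldType) (gT : finGroupType) (L : algClosure F).
Hypothesis coqn : coprime #|F| (exponent [set: gT]).
Variable psi : character gT L.
Local Notation d := (char_order psi).
Local Notation E := (char_field psi).
Local Notation K := (se_sort E).
Local Notation f := (char_trace psi).
Local Notation nG := (#|[set: gT]|%:R : K).

Let nG_neq0 : nG != 0.
Proof.
by rewrite -(rmorph_nat (in_alg K)) fmorph_eq0 card_group_neq0.
Qed.

(** The values of psi are powers of omega, so psi is defined over the finite
    field K = F(omega), where its Galois conjugates can be written down. *)
Lemma char_descent : exists chi : character gT K,
  (forall g, se_in E (chi g) = psi g) /\
  (forall g, char_trace_ext psi g =
     nG^-1 * \sum_(s in 'Gal({:K} / 1)%g) s (chi g)).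
Proof.
have inj := fmorph_inj (se_in E).
pose chi g : K := nG * char_idem_ext psi g.
have chiE g : se_in E (chi g) = psi g.
  rewrite rmorphM rmorph_nat char_idem_extE ffunE mulVKf //.
  by rewrite -(rmorph_nat (se_in E)) fmorph_eq0.
have chi_neq0 g : chi g != 0 by rewrite -(fmorph_eq0 (se_in E)) chiE char_neq0.
have chiM g h : chi (g * h)%g = chi g * chi h.
  by apply: inj; rewrite [RHS]rmorphM !chiE Defs.charM.
exists (Character chi_neq0 chiM); split=> //= g.
rewrite ffunE mulr_sumr; apply: eq_bigr => s _.
by rewrite /chi rmorphM rmorph_nat mulKf.
Qed.

(** Galois conjugates of psi are distinct.  An automorphism is some
    x |-> x ^ (q ^ i); if it fixes the values of psi then d divides q ^ i - 1,
    so it fixes the generator omega of K as well. *)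
Lemma gal_eq1 (chi : character gT K) (s : gal_of {:K}) :
    (forall g, se_in E (chi g) = psi g) ->
  s \in 'Gal({:K} / 1)%g -> (forall g, s (chi g) = chi g) -> s = 1%g.
Proof.
move=> chiE Gs s_chi; have [i Ds] := gal_expr Gs.
have [w Dw genw] := se_gen E.
have wd : w ^+ d = 1.
  apply: (fmorph_inj (se_in E)); rewrite rmorphXn rmorph1 /= Dw.
  exact/prim_expr_order/omega_prim/char_order_natr_neq0.
have q_gt0 := card_finField_exp_gt0 F i.
have /dvdnP[k Dk] : (d %| (#|F| ^ i).-1)%N.
  apply: char_order_dvd => g; apply: (mulfI (char_neq0 psi g)).
  by rewrite -exprS prednK // mulr1 -chiE -rmorphXn -Ds s_chi.
have sw : s w = w.
  by rewrite Ds -(prednK q_gt0) Dk exprS mulnC exprM wd expr1n mulr1.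
apply/eqP/gal_eqP=> x _; rewrite gal_id.
have : x \in <<1; w>>%VS by rewrite genw memvf.
case/Fadjoin_polyP=> p p1 ->; rewrite -horner_map /= sw.
by rewrite (fixedPoly_gal (sub1v _) Gs).
Qed.

(** Pairing f with the inverse of psi counts the automorphisms that fix psi,
    and only the identity does; the count must be exact, since a larger
    stabilizer could have order 0 in K. *)
Lemma char_trace_neq0 : f != 0.
Proof.
apply/eqP=> f0; have [chi [chiE trE]] := char_descent.
have /eqP[] := oner_neq0 K.
have <- : \sum_g (f g)%:A * (chi g)^-1 = 1 :> K.
  under eq_bigr => g _ do rewrite char_traceE trE -mulrA mulr_suml.
  rewrite -mulr_sumr exchange_big (bigD1 1%g) ?group1 //= [X in _ + X]big1.
    under eq_bigr => g _ do rewrite gal_id divff ?char_neq0 //.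
    by rewrite sumr_const addr0 -cardsT mulVf.
  move=> s /andP[Gs ns1].
  have [g ng] : exists g, s (chi g) != chi g.
    apply/existsP; rewrite -negb_forall; apply: contra ns1 => /forallP s_chi.
    by apply/eqP/(gal_eq1 chiE Gs) => g; apply/eqP.
  apply: (@char_sum_eq0 _ _ (fun g => s (chi g) / chi g) g).
    by move=> h k; rewrite !Defs.charM rmorphM invfM mulrACA.
  by apply: contra ng => /eqP/divr1_eq->.
by rewrite f0 big1 // => g _; rewrite ffunE scale0r mul0r.
Qed.

(** The coefficients of f f* are combinations of the sums over h of
    s(psi h) t(psi h), with s and t in the Galois group.  These vanish by
    orthogonality unless t psi is the inverse of s psi, and then s t^-1 maps
    psi to its inverse. *)
Lemma char_inverse_conjugate :
  f * grpalg_star f != 0 -> exists t, (d %| (#|F| ^ t).+1)%N.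
Proof.
have [chi [chiE trE]] := char_descent.
pose G := 'Gal({:K} / 1)%g.
case: (boolP [exists s in G, exists t in G,
               forall g, s (chi g) * t (chi g) == 1]).
  case/exists_inP=> s Gs /exists_inP[t Gt /forallP st] _.
  have [i Di] : exists i, forall x, (s * t^-1)%g x = x ^+ (#|F| ^ i).
    by apply: gal_expr; rewrite groupM ?groupV.
  exists i; apply: char_order_dvd => g; rewrite exprSr -chiE -rmorphXn -Di.
  rewrite -rmorphM galM ?memvf //.
  have -> : s (chi g) = t (chi g)^-1.
    by rewrite fmorphV; apply: divr1_eq; rewrite invrK; apply/eqP/st.
  by rewrite -galM ?memvf // mulgV gal_id mulVf ?char_neq0 ?rmorph1.
move=> no_st /eqP[]; apply/ffunP=> g; rewrite [RHS]ffunE.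
apply: (fmorph_inj (in_alg K)); rewrite rmorph0 ffunE rmorph_sum /=.
transitivity (\sum_h (nG^-1 * nG^-1) * \sum_(s in G) \sum_(t in G)
    s (chi h) * t (chi (g^-1 * h)%g)).
  apply: eq_bigr => h _; rewrite [grpalg_star _ _]ffunE invMg invgK.
  rewrite [LHS](rmorphM (in_alg K)) /= !char_traceE !trE mulrACA big_distrlr.
  by [].
rewrite -mulr_sumr exchange_big big1 ?mulr0 // => s Gs.
rewrite exchange_big big1 // => t Gt.
have [h nh] : exists h, s (chi h) * t (chi h) != 1.
  apply/existsP; rewrite -negb_forall; apply: contra no_st => st.
  by apply/exists_inP; exists s => //; apply/exists_inP; exists t.
under eq_bigr => k _ do rewrite Defs.charM rmorphM mulrCA.
rewrite -mulr_sumr.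
rewrite (@char_sum_eq0 _ _ (fun k => s (chi k) * t (chi k)) h) ?mulr0 //.
by move=> k l; rewrite !Defs.charM !rmorphM mulrACA.
Qed.

End CharacterIdempotents.

(** * The characterization *)

Theorem theorem4p3 (F : finFieldType) (gT : finGroupType) (L : algClosure F)
    (n : nat)
    (abelG : abelian [set: gT])
    (expG : exponent [set: gT] = n)
    (coqn : coprime #|F| n) :
  star_clean (@grpalg_star F gT)
  <->
  [\/ (forall C : {set grpalg F gT}, abelian_code C -> LCD C),
      (forall C : {set grpalg F gT}, abelian_code C -> ~~ self_orthogonal C),
      (exists psi : character gT L, char_order psi = n /\ LCD (char_code psi))
    | (exists psi : character gT L,
         char_order psi = n /\ ~~ self_orthogonal (char_code psi))].
Proof.
have coqe : coprime #|F| (exponent [set: gT]) by rewrite expG.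
split=> [clean | ]; first by apply: Or41; apply/star_clean_LCD.
have clean_of_conj (psi : character gT L) : char_order psi = n ->
    ~~ self_orthogonal (char_code psi) -> star_clean (@grpalg_star F gT).
  move=> ord_psi nso.
  have [|t] := @char_inverse_conjugate F gT L coqe psi.
    apply: contra nso => /eqP ff0.
    exact: generated_code_self_orthogonal.
  rewrite ord_psi => n_dvd.
  apply/(star_cleanP abelG coqe) => e ee.
  have gq (g : gT) : (g ^+ (#|F| ^ t) = g^-1)%g.
    apply/(mulIg g); rewrite mulVg -expgSr; apply/eqP.
    rewrite -order_dvdn (dvdn_trans _ n_dvd) // -expG.
    by rewrite dvdn_exponent ?inE.
  rewrite -(grpalg_exprq_star abelG e gq).
  by rewrite -(prednK (card_finField_exp_gt0 F t)) idem_exprS.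
case=> [allLCD | noSO | [psi [ord_psi lcd]] | [psi [ord_psi nso]]].
- exact/star_clean_LCD.
- (* the zero ideal contradicts this condition *)
  have code0 : abelian_code (generated_code (0 : grpalg F gT)).
    exact: generated_code_code.
  have /negP[] := noSO _ code0.
  by apply: generated_code_self_orthogonal; rewrite ?mul0r.
- apply: (clean_of_conj psi ord_psi).
  apply: contra (char_trace_neq0 coqe psi) => so.
  by apply/eqP/(self_orthogonal_LCD_eq0 abelG).
exact: clean_of_conj nso.
Qed.
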